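(* Let $K$ be a compact, linearly ordered space, and suppose that $C(K)$ admits an equivalent norm whose dual norm on $C(K)^*$ is strictly convex. Then $K$ is metrisable.
   Context: All topological spaces are Hausdorff. A linearly ordered space is a linearly ordered set equipped with its order topology. $C(K)$ is the Banach space of continuous real-valued functions on $K$, with the supremum norm; an equivalent norm is a norm inducing the same topology. A norm is strictly convex if its unit sphere contains no non-degenerate line segments. *)

(* Defs.v *)
From HB Require Import structures.
From mathcomp Require Import all_boot all_order all_algebra.
From mathcomp Require Import all_classical all_reals all_analysis.

Set Implicit Arguments.
Unset Strict Implicit.
Unset Printing Implicit Defensive.

Import Order.TTheory GRing.Theory Num.Theory.
Import numFieldNormedType.Exports.

Local Open Scope classical_set_scope.
Local Open Scope ring_scope.

(* Compactness of [K] is a parameter of the type, so that the supremum norm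
   is finite and gives a [normedModType] instance on it. *)
Definition C_space (R : realType) (K : topologicalType)
    (cK : compact [set: K]) : Type :=
  continuousType K R.

Section C_space_lmodule.
Context {R : realType} {K : topologicalType} {cK : compact [set: K]}.
Local Notation CK := (C_space R cK).

Definition C_fun (f : CK) : K -> R := (f : continuousType K R).

Lemma C_fun_continuous (f : CK) : continuous (C_fun f).
Proof. exact: (@cts_fun _ _ f). Qed.

Definition C_mk (f : K -> R) (cf : continuous f) : CK :=
  (mkcts cf : continuousType K R).

Lemma C_funP (f g : CK) : C_fun f =1 C_fun g -> f = g.
Proof. by move/continuousEP. Qed.

Lemma C_zero_subproof : continuous (fun _ : K => 0 : R).
Proof. by move=> x; exact: cvg_cst. Qed.

Lemma C_opp_subproof (f : CK) : continuous (fun x => - C_fun f x).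
Proof. by move=> x; apply: cvgN; exact: C_fun_continuous. Qed.

Lemma C_add_subproof (f g : CK) : continuous (fun x => C_fun f x + C_fun g x).
Proof. by move=> x; apply: cvgD; exact: C_fun_continuous. Qed.

Lemma C_scale_subproof (a : R) (f : CK) : continuous (fun x => a * C_fun f x).
Proof. by move=> x; apply: cvgM; [exact: cvg_cst|exact: C_fun_continuous]. Qed.

Definition C_zero : CK := C_mk C_zero_subproof.
Definition C_opp (f : CK) : CK := C_mk (@C_opp_subproof f).
Definition C_add (f g : CK) : CK := C_mk (@C_add_subproof f g).
Definition C_scale (a : R) (f : CK) : CK := C_mk (@C_scale_subproof a f).

Lemma C_addA : associative C_add.
Proof. by move=> f g h; apply: C_funP => x; exact: addrA. Qed.
Lemma C_addC : commutative C_add.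
Proof. by move=> f g; apply: C_funP => x; exact: addrC. Qed.
Lemma C_add0 : left_id C_zero C_add.
Proof. by move=> f; apply: C_funP => x; exact: add0r. Qed.
Lemma C_addN : left_inverse C_zero C_opp C_add.
Proof. by move=> f; apply: C_funP => x; exact: addNr. Qed.

HB.instance Definition _ := Choice.copy CK (continuousType K R).
HB.instance Definition _ :=
  GRing.isZmodule.Build CK C_addA C_addC C_add0 C_addN.

Lemma C_scaleA a b (f : CK) : C_scale a (C_scale b f) = C_scale (a * b) f.
Proof. by apply: C_funP => x; exact: mulrA. Qed.
Lemma C_scale1 : left_id 1 C_scale.
Proof. by move=> f; apply: C_funP => x; exact: mul1r. Qed.
Lemma C_scaleDr : right_distributive C_scale +%R.
Proof. by move=> a f g; apply: C_funP => x; exact: mulrDr. Qed.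
Lemma C_scaleDl (f : CK) : {morph C_scale^~ f : a b / a + b}.
Proof. by move=> a b; apply: C_funP => x; exact: mulrDl. Qed.

HB.instance Definition _ :=
  GRing.Zmodule_isLmodule.Build R CK C_scaleA C_scale1 C_scaleDr C_scaleDl.

Definition sup_norm (f : CK) : R := sup [set `|C_fun f x| | x in [set: K]].

Lemma sup_norm_ub (f : CK) :
  has_ubound [set `|C_fun f x| | x in [set: K]].
Proof.
have cf : {within [set: K], continuous (fun x => `|C_fun f x|)}.
  apply: continuous_subspaceT => x.
  by apply: cvg_norm; exact: C_fun_continuous.
have [M [_ MB]] := compact_bounded (continuous_compact cf cK).
exists (M + 1) => _ [x _ <-].
have /MB/(_ `|C_fun f x|) : M < M + 1 by rewrite ltrDl ltr01.
by rewrite /= normr_id; apply; exists x.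
Qed.

Lemma sup_norm_ge (f : CK) x : `|C_fun f x| <= sup_norm f.
Proof. by apply: ub_le_sup; [exact: sup_norm_ub|exists x]. Qed.

Lemma sup_norm_ge0 (f : CK) : 0 <= sup_norm f.
Proof.
have [[x _]|/set0P/negP/negPn/eqP K0] := pselect ([set: K] !=set0).
  exact: le_trans (sup_norm_ge f x).
by rewrite /sup_norm K0 image_set0 sup0.
Qed.

Lemma sup_norm_le (f : CK) (M : R) :
  0 <= M -> (forall x, `|C_fun f x| <= M) -> sup_norm f <= M.
Proof.
move=> M0 fM; have [[x _]|/set0P/negP/negPn/eqP K0] := pselect ([set: K] !=set0).
  by apply: ge_sup => [|_ [y _ <-]//]; exists `|C_fun f x|, x.
by rewrite /sup_norm K0 image_set0 sup0.
Qed.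

Lemma sup_normD (f g : CK) : sup_norm (f + g) <= sup_norm f + sup_norm g.
Proof.
apply: sup_norm_le => [|x]; first by rewrite addr_ge0 ?sup_norm_ge0.
by rewrite (le_trans (ler_normD _ _))// lerD ?sup_norm_ge.
Qed.

Lemma sup_normZ (a : R) (f : CK) : sup_norm (a *: f) = `|a| * sup_norm f.
Proof.
have leZ b g : sup_norm (b *: g) <= `|b| * sup_norm g.
  apply: sup_norm_le => [|x]; first by rewrite mulr_ge0 ?sup_norm_ge0.
  by rewrite normrM ler_wpM2l ?sup_norm_ge.
apply/eqP; rewrite eq_le leZ /=.
have [->|a0] := eqVneq a 0; first by rewrite normr0 mul0r sup_norm_ge0.
rewrite -ler_pdivlMl ?normr_gt0// -normfV.
by rewrite (le_trans _ (leZ _ _))// scalerA mulVf// scale1r.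
Qed.

Lemma sup_norm_eq0 (f : CK) : sup_norm f = 0 -> f = 0.
Proof.
move=> f0; apply: C_funP => x.
by apply/eqP; rewrite -normr_le0 -f0 sup_norm_ge.
Qed.

HB.instance Definition _ :=
  @Lmodule_isNormed.Build R CK sup_norm sup_normD sup_normZ sup_norm_eq0.

End C_space_lmodule.

Section dual_space.
Context {R : realType} (V : normedModType R).

Definition dual_pred : {pred V -> R^o} :=
  [pred phi : V -> R^o | `[< linear phi /\ continuous phi >]].

Lemma dual_submod_closed : submod_closed dual_pred.
Proof.
split=> [|a phi psi /asboolP[lphi cphi] /asboolP[lpsi cpsi]]; apply/asboolP.
  split=> [b u v|x]; last exact: cvg_cst.
  by rewrite scaler0 addr0.
split=> [b u v|x].
  rewrite !fctE lphi lpsi /= !scalerDr !scalerA.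
  by rewrite (mulrC a b) addrACA.
by apply: cvgD; [apply: cvgZr; exact: cphi|exact: cpsi].
Qed.

HB.instance Definition _ :=
  GRing.isSubmodClosed.Build R (V -> R^o) dual_pred dual_submod_closed.

Record dual := Dual { dual_val :> V -> R^o ; dualP : dual_val \in dual_pred }.

HB.instance Definition _ := [isSub for dual_val].
HB.instance Definition _ := [Choice of dual by <:].
HB.instance Definition _ := [SubChoice_isSubLmodule of dual by <:].

End dual_space.

Section norms.
Context {R : realType}.

Definition is_norm (V : lmodType R) (N : V -> R) : Prop :=
  [/\ forall x y, N (x + y) <= N x + N y,
      forall a x, N (a *: x) = `|a| * N x &
      forall x, N x = 0 -> x = 0].

Definition equivalent_norm (V : normedModType R) (N : V -> R) : Prop :=
  is_norm N /\
  forall x : V, nbhs x = nbhs_ball_ (fun x e => [set y | N (x - y) < e]) x.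

Definition dual_norm (V : normedModType R) (N : V -> R) (phi : dual V) : R :=
  sup [set `|phi x| | x in [set x | N x <= 1]].

Definition strictly_convex (V : lmodType R) (N : V -> R) : Prop :=
  ~ exists x y : V, x <> y /\
      forall t : R, 0 <= t <= 1 -> N ((1 - t) *: x + t *: y) = 1.

End norms.

Definition metrizable (R : realType) (T : topologicalType) : Prop :=
  exists dist : T -> T -> R,
    [/\ forall x y, dist x y = 0 <-> x = y,
        forall x y, dist x y = dist y x,
        forall x y z, dist x z <= dist x y + dist y z &
        forall x, nbhs x = nbhs_ball_ (fun x e => [set y | dist x y < e]) x].

(* Main.v *)
Require Import Defs.
From HB Require Import structures.
From mathcomp Require Import all_boot all_order all_algebra.
From mathcomp Require Import all_classical all_reals all_analysis.
From mathcomp Require Import lra.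

(** Why the theorem holds.

    Let [N] be an equivalent norm on [C(K)] whose dual norm [N*] is strictly
    convex.  For distinct functionals [phi] and [psi] the midpoint has dual
    norm less than the larger of [N* phi] and [N* psi]
    ([dual_norm_midpoint]).  Take a rational [q] in between.  No slice
    [{chi | q < chi u}] with [N u <= 1] contains both functionals, since it
    would contain the midpoint, whose norm is less than [q], but some slice
    contains one of them.  Pulled back along [x |-> delta_x], the slices of
    level [q] form a family [U q] of open subsets of [K], and the countably
    many families [U q] separate points: for [x <> y] there is [q] such that
    some member of [U q] contains [x] or [y], and no member contains both
    ([strictly_convex_dual_families]).

    The rest is order theory.  A compact linearly ordered space is a complete
    linear order.  Close a countable set [D] under sufficiently many
    operations that can be defined from [U]; this plays the role of a countable
    elementary submodel.  The claim ([order_separable]) is that any [x < y]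
    with no point of [D] strictly in between both belong to [D].  Enclose
    [x, y] in a gap [a < b] of [D], with [a] the supremum of the points of [D]
    up to [x] and [b] the infimum of those from [y] on.  If [a] and [b] are in
    [D], nothing lies between them, since [D] is made to meet every nonempty
    open interval between two of its points; so [x = a] and [y = b].

    If [a] is not in [D], it is a limit of [D] from the left.  When a member of
    [U n] contains [a], it contains a whole interval [[p, a]] with [p] in [D],
    and the supremum [e] of the points [z] for which [[p, z]] lies in a member
    of [U n] belongs to [D].  So [e > a], the gap forces [e >= b], and every
    point of the gap lies together with [a] in some member of [U n]
    ([reach_right]).  If neither [a] nor [b] is in [D], this and its mirror
    image contradict separation of [a] and [b] ([no_two_sided_gap]).  If only
    [b] is in [D], then no countable set below [b] is cofinal in [b], and an
    interleaving argument, as for closed unbounded subsets of [omega_1], gives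
    [a'] in the gap that avoids the union of [U n] for every [n] for which [a]
    avoids it ([common_gap]).  No [n] can then separate [a] from [a']
    ([no_left_gap]).  The case where only [a] is in [D] is the same statement
    in the reverse order.

    Hence every [x < y] has two points of [D] in [[x, y]], and Urysohn functions
    for the pairs of points of [D] are a countable family of continuous
    functions separating the points of [K], which metrises the compact space
    [K] ([separating_metrizable]). *)

Set Implicit Arguments.
Unset Strict Implicit.
Unset Printing Implicit Defensive.

Import Order.TTheory GRing.Theory Num.Theory.
Import numFieldNormedType.Exports.

Local Open Scope classical_set_scope.
Local Open Scope ring_scope.

(** * Countable closures *)

Lemma countableU (T : Type) (A B : set T) :
  countable A -> countable B -> countable (A `|` B).
Proof.
by move=> cA cB; rewrite -bigcup2E; apply: bigcup_countable => // -[|[|k]] _ /=.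
Qed.

(** This stands in for the downward Lowenheim-Skolem theorem: it produces the
    countable set that imitates an elementary submodel. *)
Lemma countable_closure (T : Type) (C0 : set T) (F : T -> T -> set T) :
  countable C0 -> (forall x y, countable (F x y)) ->
  exists D, [/\ countable D, C0 `<=` D &
    forall x y, D x -> D y -> F x y `<=` D].
Proof.
move=> cC0 cF.
pose next (A : set T) := A `|` \bigcup_(p in A `*` A) F p.1 p.2.
pose stage n := iter n next C0.
have stageS n : stage n `<=` stage n.+1 by move=> x; left.
have stage_le m n : (m <= n)%N -> stage m `<=` stage n.
  move/subnK <-; elim: (n - m)%N => [//|k IH].
  exact: subset_trans IH (stageS _).
exists (\bigcup_n stage n); split.
- apply: bigcup_countable => // n _; elim: n => [//|n IH].
  apply: countableU => //.
  by apply: bigcup_countable; [exact: countableX|].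
- by move=> x C0x; exists 0%N.
- move=> x y [m _ xm] [n _ yn] z zF; exists (maxn m n).+1 => //; right.
  exists (x, y) => //; split.
    exact: (stage_le m) (leq_maxl _ _) _ xm.
  exact: (stage_le n) (leq_maxr _ _) _ yn.
Qed.

(** * Families of sets that separate points *)

Definition covered {T I : Type} (U : I -> set (set T)) (n : I) : set T :=
  \bigcup_(V in U n) V.

Definition linked {T I : Type} (U : I -> set (set T)) (n : I) (x y : T) :=
  exists V, [/\ U n V, V x & V y].

(** * Gaps of countable sets in complete linear orders *)

(** Statements about suprema are reused for infima by applying them to the
    reverse order [L^d]. *)
Section order_core.
Local Open Scope order_scope.
Context {d : Order.disp_t} {L : orderType d} {I : countType}.
Implicit Types (U : I -> set (set L)) (A C D V : set L) (a b x y z : L).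

Definition lub A s := (forall x, A x -> x <= s) /\
  (forall u, (forall x, A x -> x <= u) -> s <= u).

Lemma lub_lt A s z : lub A s -> z < s -> exists2 x, A x & z < x.
Proof.
move=> [_ ls] zs; apply: contrapT => nx.
have : s <= z.
  by apply: ls => x Ax; rewrite leNgt; apply/negP => zx; apply: nx; exists x.
by rewrite leNgt zs.
Qed.

(** What an open set retains in the bare order: it is a neighbourhood, on the
    left, of each of its points.  The formulation through suprema needs no
    separate treatment of points with an immediate predecessor. *)
Definition left_open V := forall A a, A !=set0 -> lub A a -> V a ->
  exists2 x, A x & forall z, x <= z <= a -> V z.

Definition reach U n a : set L :=
  [set z | a <= z /\ exists2 V, U n V & forall w, a <= w <= z -> V w].

Definition gaps U n b : set L := [set z | z < b /\ ~ covered U n z].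

Definition cofinal_below A b :=
  (forall x, A x -> x < b) /\ (forall z, z < b -> exists2 x, A x & z <= x).

(** What the countable set built below must contain on account of its element
    [b]; each clause is a definable operation, as needed for a gap that is
    approached from the left. *)
Definition left_step U C b :=
  [/\ forall n, exists2 s, C s & lub (reach U n b) s,
      forall n, exists2 s, C s & lub (gaps U n b) s &
      forall A, countable A -> cofinal_below A b ->
        exists2 A', A' `<=` C & cofinal_below A' b].

Lemma left_stepS U C C' b : C `<=` C' -> left_step U C b -> left_step U C' b.
Proof.
move=> CC' [h1 h2 h3]; split.
- by move=> n; have [s Cs ?] := h1 n; exists s => //; exact: CC'.
- by move=> n; have [s Cs ?] := h2 n; exists s => //; exact: CC'.
- move=> A cA /(h3 A cA)[A' A'C ?]; exists A' => //; exact: subset_trans CC'.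
Qed.

Lemma left_step_ex U b : (forall A, exists s, lub A s) ->
  exists2 C, countable C & left_step U C b.
Proof.
move=> lubs.
have /choice[s1 s1P] n := lubs (reach U n b).
have /choice[s2 s2P] n := lubs (gaps U n b).
have [A [cA AP]] : exists A, countable A /\
    ((exists A', countable A' /\ cofinal_below A' b) -> cofinal_below A b).
  have [[A [cA AP]]|nA] :=
      pselect (exists A', countable A' /\ cofinal_below A' b).
    by exists A.
  by exists set0; split=> // /nA.
exists (range s1 `|` range s2 `|` A).
  apply: countableU => //; apply: countableU;
    exact/(sub_countable (card_image_le _ _))/countableP.
split.
- by move=> n; exists (s1 n) => //; left; left; exists n.
- by move=> n; exists (s2 n) => //; left; right; exists n.
- by move=> A' cA' A'b; exists A; [right|apply: AP; exists A'].
Qed.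

Definition left_limit D a := lub (D `&` [set x | x < a]) a.

(** [D] contains a point [p < a] with [[p, a]] inside a member of [U n].  The
    supremum [e] of [reach U n p] lies in [D], so it cannot stop at [a], which
    is outside [D]; below [e] the intervals starting at [p] still fit in
    members of [U n], and they contain [a]. *)
Lemma reach_right U D a n : (forall b, D b -> left_step U D b) ->
  (forall V, U n V -> left_open V) ->
  D `&` [set x | x < a] !=set0 -> left_limit D a -> ~ D a -> covered U n a ->
  exists e, [/\ D e, a < e & forall y, a <= y < e -> linked U n a y].
Proof.
move=> Dcl Uo D0 aD nDa [V UV Va].
have [p [Dp pa] pV] := Uo V UV _ _ D0 aD Va.
have [/(_ n)[e De elub] _ _] := Dcl p Dp.
have ae : a < e.
  rewrite lt_neqAle; apply/andP; split.
    by apply/eqP => ae; apply: nDa; rewrite ae.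
  by apply: elub.1; split; [exact: ltW|exists V].
exists e; split=> // y /andP[ay ye].
have [z [pz [W UW Wz]] yz] := lub_lt elub ye.
exists W; split=> //; apply: Wz.
  by rewrite (ltW pa) (ltW (le_lt_trans ay yz)).
by rewrite (ltW (lt_le_trans pa ay)) (ltW yz).
Qed.

(** The analogue of the fact that countably many closed unbounded subsets of
    [omega_1] have a common element.  A countable cofinal subset of [b] would
    give one inside [D], hence points of [D] in the gap, so countable sets
    below [b] are bounded below [b].  If [a] is not covered by [U n], the
    supremum of the uncovered points below [b] lies in [D] and is larger than
    [a], so it is [b]: the uncovered points are cofinal in [b].  Interleave:
    choose [s 0 = a < s 1 < ...] below [b] so that, for each such [n], there is
    a point not covered by [U n] between any two consecutive terms.  The
    supremum [a'] is not covered by [U n] either, because a member of [U n]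
    containing [a'] would contain some [[s k, a']]. *)
Lemma common_gap U D a b : (forall A, exists s, lub A s) ->
  (forall b, D b -> left_step U D b) ->
  (forall n V, U n V -> left_open V) ->
  a < b -> ~ D a -> D b -> left_limit D a ->
  (forall x, D x -> a < x -> b <= x) ->
  exists2 a', a < a' < b & forall n, ~ covered U n a -> ~ covered U n a'.
Proof.
move=> lubs Dcl Uo ab nDa Db aD gap.
have [_ Dgap Dcof] := Dcl b Db.
have unb A : countable A -> (forall x, A x -> x < b) ->
    exists2 z, z < b & forall x, A x -> x < z.
  move=> cA Ab; apply: contrapT => nz.
  have [|A' A'D [A'b /(_ a ab)[x A'x ax]]] := Dcof A cA.
    split=> // z zb; apply: contrapT => nx; apply: nz; exists z => // x Ax.
    by rewrite ltNge; apply/negP => zx; apply: nx; exists x.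
  have Dx := A'D _ A'x.
  have {}ax : a < x.
    by rewrite lt_neqAle ax andbT; apply/eqP => ax'; apply: nDa; rewrite ax'.
  by have := A'b _ A'x; rewrite ltNge (gap _ Dx ax).
have gap_cof n z : ~ covered U n a -> z < b -> exists2 w, gaps U n b w & z < w.
  move=> na zb; have [s Ds sl] := Dgap n.
  apply: (lub_lt sl); apply: lt_le_trans zb _; apply: (gap _ Ds).
  rewrite lt_neqAle; apply/andP; split; last by apply: sl.1.
  by apply/eqP => as_; apply: nDa; rewrite as_.
(* One interleaving step, for all the relevant indices at once. *)
have /choice[next nextP] z : exists z', z < b -> [/\ z < z', z' < b &
    forall n, ~ covered U n a -> exists2 w, gaps U n b w & z < w < z'].
  have [zb|] := boolP (z < b); last by exists z.
  have /choice[w wP] n : exists w, w < b /\ (~ covered U n a ->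
      gaps U n b w /\ z < w).
    have [na|na] := pselect (covered U n a); first by exists z.
    by have [w gw zw] := gap_cof n z na zb; exists w; split=> //; case: gw.
  have [||z' z'b z'P] := unb (z |` range w).
  - apply: countableU; first exact: countable1.
    exact/(sub_countable (card_image_le _ _))/countableP.
  - by move=> x [->//|[n _ <-]]; have [] := wP n.
  - exists z' => _; split=> //; first by apply: z'P; left.
    move=> n /(wP n).2[gw zw]; exists (w n) => //.
    by rewrite zw z'P//; right; exists n.
pose s k := iter k next a.
have sb k : s k < b by elim: k => [//|k /nextP[]].
have sS k : s k < s k.+1 by have [] := nextP _ (sb k).
have [z zb zP] : exists2 z, z < b & forall x, range s x -> x < z.
  apply: unb => [|x [k _ <-]//].
  exact/(sub_countable (card_image_le _ _))/countableP.
have [a' a'l] := lubs (range s).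
exists a'.
  apply/andP; split.
    by apply: lt_le_trans (sS 0%N) _; apply: a'l.1; exists 1%N.
  by apply: le_lt_trans zb; apply: a'l.2 => x /zP/ltW.
move=> n na [V UV Va'].
have [|_ [k _ <-] kV] := Uo n V UV (range s) a' _ a'l Va'.
  by exists a; exists 0%N.
have [_ _ /(_ n na)[w [_ nw] /andP[sw ws]]] := nextP _ (sb k).
apply: nw; exists V => //; apply: kV; rewrite (ltW sw) /=.
by apply: le_trans (ltW ws) _; apply: a'l.1; exists k.+1.
Qed.

Definition separating U := forall x y, x < y -> exists n,
  (covered U n x \/ covered U n y) /\ ~ linked U n x y.

(** Whichever index is chosen to separate [a] from the point [a'] of
    [common_gap], it covers [a], and then [reach_right] links [a] and [a']. *)
Lemma no_left_gap U D a b : (forall A, exists s, lub A s) ->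
  (forall b, D b -> left_step U D b) ->
  (forall n V, U n V -> left_open V) -> separating U ->
  a < b -> ~ D a -> D b -> D `&` [set x | x < a] !=set0 -> left_limit D a ->
  (forall x, D x -> a < x -> b <= x) -> False.
Proof.
move=> lubs Dcl Uo sep ab nDa Db D0 aD gap.
have [a' /andP[aa' a'b] ngap] := common_gap lubs Dcl Uo ab nDa Db aD gap.
have [n [nc nl]] := sep _ _ aa'.
have ca : covered U n a.
  by apply: contrapT => /[dup] /ngap ??; case: nc.
have [e [De ae eP]] := reach_right Dcl (Uo n) D0 aD nDa ca.
by apply: nl; apply: eP; rewrite (ltW aa') (lt_le_trans a'b)// gap.
Qed.

End order_core.

Section order_dual.
Local Open Scope order_scope.
Context {d : Order.disp_t} {L : orderType d} {I : countType}.
Implicit Types (U : I -> set (set L)) (A C D V : set L) (a b x y z : L).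

Local Notation glb := (@lub _ (L^d)).

Lemma lubs_dual : (forall A, exists s, lub A s) -> forall A, exists s, glb A s.
Proof.
move=> lubs A; have [s [s1 s2]] := lubs [set u | forall x, A x -> u <= x].
exists s; split => [x Ax|u uP]; first by apply: s2 => u; apply.
exact: s1.
Qed.

Lemma separating_dual U : separating U -> separating (L := L^d) U.
Proof.
move=> sep x y; rewrite ltEdual => /sep[n [h1 h2]]; exists n; split.
  by case: h1; [right|left].
by move=> [V [? ? ?]]; apply: h2; exists V.
Qed.

(** The separating index covers [a] or [b]; the reach from its side passes
    across the gap, and past the other endpoint since that is not in [D]. *)
Lemma no_two_sided_gap U D a b :
  (forall b, D b -> left_step U D b) ->
  (forall b, D b -> left_step (L := L^d) U D b) ->
  (forall n V, U n V -> left_open V) ->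
  (forall n V, U n V -> left_open (L := L^d) V) -> separating U ->
  a < b -> ~ D a -> ~ D b ->
  D `&` [set x | x < a] !=set0 -> left_limit D a ->
  D `&` [set x | b < x] !=set0 -> left_limit (L := L^d) D b ->
  (forall x, D x -> a < x -> b <= x) -> False.
Proof.
move=> Dl Dr Uo Uo' sep ab nDa nDb Da0 aD Db0 bD gap.
have [n [nc nl]] := sep _ _ ab; apply: nl.
case: nc => cn.
  have [e [De ae]] := reach_right Dl (Uo n) Da0 aD nDa cn.
  apply; rewrite (ltW ab) lt_neqAle gap// andbT.
  by apply/eqP => be; apply: nDb; rewrite be.
have [e [De be eP]] := reach_right (L := L^d) Dr (Uo' n) Db0 bD nDb cn.
have [|V [UV Vb Va]] := eP a; last by exists V.
rewrite leEdual ltEdual (ltW ab) /=.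
rewrite ltNge; apply/negP; rewrite le_eqVlt => /orP[/eqP ae|ae].
  by apply: nDa; rewrite ae.
by move: be; rewrite ltEdual ltNge gap.
Qed.

(** The hypotheses on [U] make the order embeddable in the real line: [D] is an
    order-dense countable set in the sense of Birkhoff and Debreu, in which
    both ends of every jump are included. *)
Lemma order_separable U : (forall A, exists s, lub A s) ->
  (forall n V, U n V -> left_open V) ->
  (forall n V, U n V -> left_open (L := L^d) V) -> separating U ->
  exists2 D, countable D & forall x y, x < y ->
    exists d1 d2, [/\ D d1, D d2, x <= d1, d1 < d2 & d2 <= y].
Proof.
move=> lubs Uo Uo' sep.
have glbs := lubs_dual lubs; have sep' := separating_dual sep.
have [bot [_ botP]] := lubs set0.
have [top [_ topP]] : exists top : L, glb set0 top by exact: glbs.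
have {}botP x : bot <= x by exact: botP.
have {}topP x : x <= top by exact: topP.
have /choice[CL CLP] b : exists C, countable C /\ left_step U C b.
  by have [C ? ?] := left_step_ex U b lubs; exists C.
have /choice[CR CRP] b : exists C, countable C /\ left_step (L := L^d) U C b.
  by have [C ? ?] := left_step_ex (L := L^d) U b glbs; exists C.
have /choice[btw btwP] (p : L * L) : exists z, (exists z, p.1 < z < p.2) ->
    p.1 < z < p.2.
  have [[z zP]|nz] := pselect (exists z, p.1 < z < p.2); first by exists z.
  by exists p.1 => /nz.
have [|x y|D [cD D0 Dcl]] := @countable_closure L [set bot; top]
   (fun x y => CL x `|` CR x `|` [set btw (x, y)]).
- exact/finite_set_countable/finite_set2.
- apply: countableU; last exact: countable1.
  by apply: countableU; [exact: (CLP x).1|exact: (CRP x).1].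
have Dbot : D bot by apply: D0; left.
have Dtop : D top by apply: D0; right.
have Dl b : D b -> left_step U D b.
  move=> Db; apply: left_stepS (CLP b).2 => z Cz.
  by apply: (Dcl b b) => //; left; left.
have Dr b : D b -> left_step (L := L^d) U D b.
  move=> Db; apply: left_stepS (CRP b).2 => z Cz.
  by apply: (Dcl b b) => //; left; right.
have Dbtw a b z : D a -> D b -> a < z < b -> exists2 w, D w & a < w < b.
  move=> Da Db azb; exists (btw (a, b)).
    by apply: (Dcl a b) => //; right.
  by apply: (btwP (a, b)); exists z.
(* The gap of [D] around [x] and [y] is of one of the kinds excluded by the
   preceding lemmas unless both its endpoints are in [D]. *)
have key x y : x < y -> (forall z, D z -> ~ x < z < y) -> D x /\ D y.
  move=> xy xyD.
  have [a alub] := lubs (D `&` [set z | z <= x]).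
  have [b bglb] : exists b : L, glb (D `&` [set z | y <= z]) b by exact: glbs.
  have bmin z : D z -> y <= z -> b <= z.
    by move=> Dz yz; exact: (bglb.1 z (conj Dz yz)).
  have ax : a <= x by apply: alub.2 => z [].
  have yb : y <= b by apply: bglb.2 => z [].
  have ab : a < b := le_lt_trans ax (lt_le_trans xy yb).
  have gap z : D z -> a < z -> b <= z.
    move=> Dz az; have [zx|xz] := leP z x.
      by move: az; rewrite ltNge alub.1.
    have [yz|zy] := leP y z; first exact: bmin.
    by case: (xyD z Dz); rewrite xz.
  have gap' z : D z -> z < b -> z <= a.
    move=> Dz zb; rewrite leNgt; apply/negP => /(gap z Dz).
    by rewrite leNgt zb.
  have lima : ~ D a -> D `&` [set z | z < a] !=set0 /\ left_limit D a.
    move=> nDa; have lta z : D z -> z <= a -> z < a.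
      move=> Dz za; rewrite lt_neqAle za andbT; apply/eqP => zE.
      by rewrite -zE in nDa.
    split; first by exists bot; split=> //; exact: lta.
    split=> [z [_ /ltW]//|u uP]; apply: alub.2 => z [Dz zx].
    by apply: uP; split=> //; apply: lta => //; apply: alub.1.
  have limb : ~ D b ->
      D `&` [set z | b < z] !=set0 /\ left_limit (L := L^d) D b.
    move=> nDb; have ltb z : D z -> b <= z -> b < z.
      move=> Dz bz; rewrite lt_neqAle bz andbT; apply/eqP => zE.
      by rewrite zE in nDb.
    split; first by exists top; split=> //; exact: ltb.
    split=> [z [_ /ltW]//|u uP]; apply: bglb.2 => z [Dz yz].
    by apply: uP; split=> //; apply: ltb => //; exact: bmin.
  have [Da|nDa] := pselect (D a); have [Db|nDb] := pselect (D b).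
  - have nab z : ~ a < z < b.
      move=> azb; have [w Dw /andP[aw wb]] := Dbtw a b z Da Db azb.
      by move: wb; rewrite ltNge gap.
    split.
      have [<-//|nx] := eqVneq a x; case: (nab x).
      by rewrite lt_neqAle nx ax (lt_le_trans xy yb).
    have [->//|ny] := eqVneq y b; case: (nab y).
    by rewrite (le_lt_trans ax xy) lt_neqAle ny yb.
  - have [Db0 bD] := limb nDb.
    case: (@no_left_gap _ (L^d) _ U D b a glbs Dr Uo' sep' ab nDb Da Db0 bD).
    exact: gap'.
  - have [Da0 aD] := lima nDa.
    by case: (no_left_gap lubs Dl Uo sep ab nDa Db Da0 aD).
  - have [Da0 aD] := lima nDa; have [Db0 bD] := limb nDb.
    by case: (no_two_sided_gap Dl Dr Uo Uo' sep ab nDa nDb Da0 aD Db0 bD).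
exists D => // x y xy; apply: contrapT => nd.
(* A point [z] of [D] between [x] and [y] may be the only one; then the pair
   [x < z] has none in between, and [x] itself is in [D]. *)
have [[z [Dz /andP[xz zy]]]|nz] := pselect (exists z, D z /\ x < z < y).
  have [|Dx _] := key x z xz.
    move=> w Dw /andP[xw wz]; apply: nd; exists w, z; split=> //.
      exact: ltW xw.
    exact: ltW zy.
  by apply: nd; exists x, z; rewrite lexx xz ltW.
have [|Dx Dy] := key x y xy.
  by move=> z Dz zP; apply: nz; exists z.
by apply: nd; exists x, y; rewrite !lexx xy.
Qed.

End order_dual.

(** * Compact linearly ordered spaces *)

(** A cluster point of the final segments of [A].  The relation [r] is the order
    or its reverse, so that this gives suprema and also the least element, which
    is the supremum of the empty set. *)
Lemma compact_total_extremum (T : topologicalType) (r : rel T) (A : set T) :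
  compact [set: T] -> total r -> transitive r ->
  (forall x, closed [set z | r x z]) -> (forall x, closed [set z | r z x]) ->
  A !=set0 -> exists p, (forall x, A x -> r x p) /\
    (forall u, (forall x, A x -> r x u) -> r p u).
Proof.
move=> cT rtot rtr clr cll [x0 Ax0].
have rr x : r x x by have := rtot x x; rewrite orbb.
pose tail x := A `&` [set z | r x z].
have Fp : ProperFilter (filter_from A tail).
  apply: filter_from_proper; last first.
    by move=> x Ax; exists x; split=> //; exact: rr.
  apply: filter_from_filter; first by exists x0.
  move=> x y Ax Ay; have [xy|yx] := orP (rtot x y).
    by exists y => // z [Az yz]; split; split=> //; exact: rtr yz.
  by exists x => // z [Az xz]; split; split=> //; exact: rtr xz.
have [|p [_]] := cT _ Fp; first by exists x0.
rewrite clusterE => pF; exists p; split => [x Ax|u uP].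
  apply: (clr x p); apply: closureS (pF (tail x) _); last by exists x.
  by move=> z [].
apply: (cll u p); apply: closureS (pF A _); last by exists x0 => // z [].
by move=> z /uP.
Qed.

Section order_topology_facts.
Context {d : Order.disp_t} {K : orderTopologicalType d}.
Local Open Scope order_scope.

Lemma compact_order_lub : compact [set: K] -> [set: K] !=set0 ->
  forall A : set K, exists s, lub A s.
Proof.
move=> cK K0 A.
have rcl (x : K) : closed [set z | x <= z].
  by have := @rray_closed _ _ x; rewrite set_itvE.
have lcl (x : K) : closed [set z | z <= x].
  by have := @lray_closed _ _ x; rewrite set_itvE.
have [->|/set0P A0] := eqVneq A set0; last first.
  have [|p [h1 h2]] := compact_total_extremum (r := <=%O) cK
     le_total _ rcl lcl A0; first by move=> ? ? ?; exact: le_trans.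
  by exists p.
have [||p [h1 _]] := compact_total_extremum (r := >=%O) cK
     _ _ lcl rcl K0.
- by move=> x y; exact: le_total.
- by move=> y x z xy yz; exact: le_trans yz xy.
by exists p; split=> // u _; exact: h1.
Qed.

Lemma nbhs_convex (V : set K) (a : K) : open V -> V a ->
  exists W : set K, [/\ nbhs a W,
    (forall x y z, W x -> W z -> x <= y <= z -> W y) & W `<=` V].
Proof.
move=> oV Va; have : nbhs a V by exact: open_nbhs_nbhs.
rewrite itv_nbhsE => -[[l r] [oi ai] iV].
exists [set` Interval l r]; split=> //.
  by exists (Interval l r).
move=> x y z /=; rewrite !itv_boundlr => /andP[ix _] /andP[_ zi] /andP[xy yz].
apply/andP; split; first by apply: le_trans ix _; rewrite bnd_simp.
by apply: le_trans zi; rewrite bnd_simp.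
Qed.

Lemma open_left_open (V : set K) : open V -> left_open V.
Proof.
move=> oV A a A0 [aub alub] Va.
have [W [Wa Wcvx WV]] := nbhs_convex oV Va.
have clA : closure A a.
  apply: (itv_closed_supremums (A := closure A)); last split.
  - by case: A0 => x Ax; exists x; exact: subset_closure.
  - exact: closed_closure.
  - have := @lray_closed _ _ a; rewrite set_itvE => cl x Ax.
    by apply: (cl x); apply: closureS Ax => z /aub.
  - by move=> u uP; apply: alub => x Ax; apply: uP; exact: subset_closure.
have [x [Ax Wx]] := clA W Wa; exists x => // z zP; apply: WV.
by apply: (Wcvx x z a) => //; exact: nbhs_singleton.
Qed.

Lemma open_right_open (V : set K) : open V -> left_open (L := K^d) V.
Proof.
move=> oV A a A0 [aub alub] Va.
have [W [Wa Wcvx WV]] := nbhs_convex oV Va.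
have clA : @closure K A a.
  apply: (@itv_closed_infimums _ K (@closure K A)); last split.
  - by case: A0 => x Ax; exists x; exact: subset_closure.
  - exact: closed_closure.
  - have := @rray_closed _ K a; rewrite set_itvE => cl x Ax.
    by apply: (cl x); apply: closureS Ax => z /aub.
  - by move=> u uP; apply: alub => x Ax; apply: uP; exact: subset_closure.
have [x [Ax Wx]] := clA W Wa; exists x => // z /andP[xz za]; apply: WV.
apply: (Wcvx a z x) => //; first exact: (@nbhs_singleton K).
by apply/andP; split.
Qed.

End order_topology_facts.

(** * Metrisation by countably many functions *)

Lemma compact_urysohn (R : realType) (T : topologicalType) (A B : set T) :
  hausdorff_space T -> compact [set: T] -> closed A -> closed B ->
  A `&` B = set0 -> exists f : T -> R, [/\ continuous f,
    forall x, 0 <= f x <= 1, forall x, A x -> f x = 0 &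
    forall x, B x -> f x = 1].
Proof.
move=> hT cT clA clB AB0.
have := normal_uniform_separator (compact_normal hT cT) clA clB AB0.
move=> /(@uniform_separatorP _ R)[f [cf f01 fA fB]]; exists f; split=> //.
- by move=> x; have /= := f01 (f x); rewrite in_itv /=; apply; exists x.
- by move=> x Ax; apply: fA; exists x.
- by move=> x Bx; apply: fB; exists x.
Qed.

Section metrization.
Context {R : realType} {T : topologicalType}.

(** The distance is the supremum of [2^-k * |f k x - f k y|].  Its balls are
    neighbourhoods because only finitely many terms matter for a given
    radius.  Conversely, if no ball around [x] fitted in a neighbourhood [U],
    the traces of the balls outside the interior of [U] would cluster at a
    point other than [x] but at distance [0] from it. *)
Lemma separating_metrizable (f : nat -> T -> R) :
  compact [set: T] -> (forall k, continuous (f k)) ->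
  (forall k x, 0 <= f k x <= 1) ->
  (forall x y, x <> y -> exists k, f k x <> f k y) -> metrizable R T.
Proof.
move=> cT cf f01 fsep.
pose t k x y : R := 2^-1 ^+ k * `|f k x - f k y|.
have w0 k : 0 < (2^-1 : R) ^+ k by rewrite exprn_gt0// invr_gt0.
have tle k x y : t k x y <= 2^-1 ^+ k.
  rewrite ler_piMr ?(ltW (w0 k))//; have /andP[? ?] := f01 k x.
  by have /andP[? ?] := f01 k y; rewrite ler_norml; apply/andP; split; lra.
pose dist x y := sup (range (fun k => t k x y)).
have dist_ge k x y : t k x y <= dist x y.
  apply: ub_le_sup; last by exists k.
  exists 1 => _ [j _ <-]; apply: le_trans (tle _ _ _) _.
  by rewrite exprn_ile1// ?invr_ge0// invf_le1 ?ler1n.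
have dist_le x y (M : R) : (forall k, t k x y <= M) -> dist x y <= M.
  by move=> tM; apply: ge_sup => [|_ [k _ <-]//]; exists (t 0%N x y), 0%N.
have tC k x y : t k x y = t k y x by rewrite /t distrC.
have distC x y : dist x y = dist y x.
  by rewrite /dist; under eq_fun do rewrite tC.
have dist_tri x y z : dist x z <= dist x y + dist y z.
  apply: dist_le => k; apply: le_trans (lerD (dist_ge k x y) (dist_ge k y z)).
  rewrite -mulrDr ler_pM2l//; apply: le_trans (ler_normD _ _).
  by rewrite addrA subrK.
have dist0 x y : dist x y = 0 <-> x = y.
  split=> [xy|->]; last first.
    apply/eqP; rewrite eq_le; apply/andP; split.
      by apply: dist_le => k; rewrite /t subrr normr0 mulr0.
    by apply: le_trans (dist_ge 0%N y y); rewrite mulr_ge0// ltW.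
  apply: contrapT => /fsep[k]; apply; apply/eqP; rewrite -subr_eq0 -normr_le0.
  by rewrite -(pmulr_rle0 _ (w0 k)) -xy; exact: dist_ge.
have dist_ge0 x y : 0 <= dist x y.
  by apply: le_trans (dist_ge 0%N x y); rewrite mulr_ge0// ltW.
have ball_nbhs x (e : R) : 0 < e -> nbhs x [set y | dist x y < e].
  move=> e0; have e20 : 0 < e / 2 by rewrite divr_gt0.
  have [n nP] : exists n, (2^-1 : R) ^+ n < e / 2.
    have : (2^-1 : R) ^+ k @[k --> \oo] --> 0.
      by apply: cvg_expr; rewrite ger0_norm ?invr_ge0// invf_lt1 ?ltr1n.
    move=> /cvgr_lt/(_ _ e20)[n _ nP]; exists n; exact: (nP n (leqnn n)).
  have : \forall y \near x, forall k, (k < n)%N -> t k x y < e / 2.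
    elim: {nP} n => [|n IH]; first by apply: nearW.
    have : \forall y \near x, t n x y < e / 2.
      have : t n x y @[y --> x] --> t n x x.
        apply: cvgMr; apply: cvg_norm; apply: cvgB; first exact: cvg_cst.
        exact: cf.
      by move=> /cvgr_lt; apply; rewrite /t subrr normr0 mulr0.
    apply: filterS2 IH => y h1 h2 k; rewrite ltnS leq_eqVlt => /predU1P[->//|].
    exact: h1.
  apply: filterS => y yP; apply: (@le_lt_trans _ _ (e / 2)); last by lra.
  apply: dist_le => k; have [kn|nk] := ltnP k n; first exact/ltW/yP.
  apply: le_trans (tle _ _ _) _; apply: le_trans (ltW nP).
  by rewrite ler_wiXn2l// ?invr_ge0// invf_le1 ?ler1n.
exists dist; split=> // x; rewrite eqEsubset; split; last first.
  by move=> U [e /= e0 eU]; apply: filterS eU _; exact: ball_nbhs.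
move=> U xU; apply: contrapT => nU.
pose B e := ~` U^° `&` [set y | dist x y < e].
have Bp : ProperFilter (filter_from [set e : R | 0 < e] B).
  apply: filter_from_proper; last first.
    move=> e e0; apply: contrapT => nB; apply: nU; exists e => // y ye.
    by apply: interior_subset; apply: contrapT => nUy; apply: nB; exists y.
  apply: filter_from_filter; first by exists 1 => /=.
  move=> e1 e2 e10 e20; exists (Num.min e1 e2); first by rewrite /= lt_min e10.
  by move=> y [nUy]; rewrite /= lt_min => /andP[? ?]; split; split.
have [|p [_ pB]] := cT _ Bp; first by exists 1 => //=.
have px : 0 < dist x p.
  rewrite lt_neqAle dist_ge0 andbT; apply/eqP => /esym/dist0 xp.
  have : nbhs p (U^°) by rewrite -xp; exact: nbhs_interior.
  have B1 : filter_from [set e : R | 0 < e] B (B 1) by exists 1 => //=.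
  by move=> /(pB _ _ B1)[y [[]]].
have r0 : 0 < dist x p / 2 by rewrite divr_gt0.
have Br : filter_from [set e : R | 0 < e] B (B (dist x p / 2)).
  by exists (dist x p / 2).
have [y [[_ /= xy] /= py]] := pB _ _ Br (ball_nbhs p _ r0).
by have := dist_tri x y p; rewrite (distC y p); lra.
Qed.

End metrization.

(** Turns a choice of one object for each index in a countable set into a
    sequence; [S] supplies the value at the unused terms. *)
Lemma countable_family (T I : Type) (P : set I) (Q : I -> T -> Prop)
    (S : set T) :
  S !=set0 -> countable P -> (forall i, P i -> exists2 f, S f & Q i f) ->
  exists f : nat -> T, (forall k, S (f k)) /\
    forall i, P i -> exists k, Q i (f k).
Proof.
move=> [f0 Sf0] /countable_injP[g ginj] PQ.
have /choice[f fP] k : exists f, S f /\ forall i, P i -> g i = k -> Q i f.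
  have [[i [Pi <-]]|nk] := pselect (exists i, P i /\ g i = k).
    have [f Sf Qf] := PQ i Pi; exists f; split=> // j Pj gji.
    by rewrite (ginj j i) ?inE.
  by exists f0; split=> // i Pi gi; case: nk; exists i.
exists f; split=> [k|i Pi]; first by have [] := fP k.
by exists (g i); apply: (fP (g i)).2.
Qed.

(** A function separating two points of [D] in the closed interval [[x, y]]
    takes the values [0] at [x] and [1] at [y]. *)
Lemma order_separable_metrizable (R : realType) (d : Order.disp_t)
    (K : orderTopologicalType d) (D : set K) :
  compact [set: K] -> countable D ->
  (forall x y : K, (x < y)%O ->
    exists d1 d2, [/\ D d1, D d2, (x <= d1)%O, (d1 < d2)%O & (d2 <= y)%O]) ->
  metrizable R K.
Proof.
move=> cK cD Dsep.
pose P := [set p : K * K | [/\ D p.1, D p.2 & (p.1 < p.2)%O]].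
pose Q (p : K * K) (f : K -> R) :=
  (forall x, (x <= p.1)%O -> f x = 0) /\ (forall x, (p.2 <= x)%O -> f x = 1).
have [||p [D1 D2 p12]|f [fS fQ]] := @countable_family (K -> R) (K * K) P Q
    [set f : K -> R | continuous f /\ forall x, 0 <= f x <= 1].
- exists (fun _ => 0); split=> [x|x]; first exact: cvg_cst.
  by rewrite lexx ler01.
- by apply: sub_countable (countableX cD cD); apply: subset_card_le => p [].
- have clL := @lray_closed _ K p.1; have clR := @rray_closed _ K p.2.
  rewrite !set_itvE in clL clR.
  have [|f [cf f01 f0 f1]] :=
      @compact_urysohn R K _ _ order_hausdorff cK clL clR.
    rewrite -subset0 => z [/= zp pz].
    by have := le_lt_trans (le_trans pz zp) p12; rewrite ltxx.
  by exists f.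
apply: (@separating_metrizable R K f) => //.
- by move=> k; exact: (fS k).1.
- by move=> k; exact: (fS k).2.
suff sep x y : (x < y)%O -> exists k, f k x <> f k y.
  move=> x y /eqP; rewrite neq_lt => /orP[/sep//|/sep[k fk]].
  by exists k => /esym.
move=> /Dsep[d1 [d2 [D1 D2 xd d12 dy]]].
have [//|k [f0 f1]] := fQ (d1, d2); exists k.
by rewrite f0// f1// => /eqP; rewrite eq_sym oner_eq0.
Qed.

(** * Strictly convex dual norms *)

Section dual_norm_theory.
Context {R : realType} (V : normedModType R) (N : V -> R).
Hypothesis eqN : equivalent_norm N.
Implicit Types (phi psi : dual V) (u v : V).

Let normN : is_norm N := eqN.1.

Lemma is_norm0 : N 0 = 0.
Proof. by have [_ NZ _] := normN; rewrite -(scale0r 0) NZ normr0 mul0r. Qed.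

Lemma dualZ phi a u : phi (a *: u) = a * phi u.
Proof.
have /asboolP[lphi _] := dualP phi.
have lphi0 : phi 0 = 0.
  have := lphi 1 0 0; rewrite !scale1r addr0 => h.
  by apply/eqP; rewrite -(subrr (phi 0)) {2}h addrK.
by rewrite -(addr0 (a *: u)) lphi lphi0 addr0.
Qed.

(** Continuity bounds [phi] on a neighbourhood of [0], which contains a ball for
    [N] because the norms are equivalent.  So the supremum defining the dual
    norm is not the default value given to unbounded sets. *)
Lemma dual_norm_ubound phi :
  has_ubound [set `|phi u| | u in [set u | N u <= 1]].
Proof.
have /asboolP[lphi cphi] := dualP phi; have [_ NZ _] := normN.
have : nbhs (0 : V) [set u | `|phi u| < 1].
  have phi0 : phi 0 = 0 by rewrite -(scale0r 0) dualZ mul0r.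
  have := cvgr_norm_lt (phi 0) (cphi 0); apply.
  by rewrite phi0 normr0 ltr01.
rewrite eqN.2 => -[r /= r0 rP]; exists (2 / r) => _ [u /= Nu <-].
have : `|phi ((r / 2) *: u)| < 1.
  apply: rP; rewrite /= sub0r -scaleN1r !NZ normrN1 mul1r gtr0_norm ?divr_gt0//.
  rewrite (le_lt_trans (ler_piMr _ Nu)) ?divr_ge0 ?ltW//.
  by rewrite ltr_pdivrMr// mulr_natr mulr2n ltrDl.
rewrite dualZ normrM gtr0_norm ?divr_gt0// mulrC -ltr_pdivlMr ?divr_gt0//.
by rewrite div1r invf_div => /ltW.
Qed.

Lemma dual_norm_ge phi u : N u <= 1 -> `|phi u| <= dual_norm N phi.
Proof. by move=> Nu; apply: ub_le_sup; [exact: dual_norm_ubound|exists u]. Qed.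

Lemma dual_norm_le phi (M : R) :
  (forall u, N u <= 1 -> `|phi u| <= M) -> dual_norm N phi <= M.
Proof.
move=> phiM; apply: ge_sup => [|_ [u Nu <-]]; last exact: phiM.
by exists `|phi 0|; exists 0 => //=; rewrite is_norm0 ler01.
Qed.

Lemma dual_norm_ge0 phi : 0 <= dual_norm N phi.
Proof.
by apply: le_trans (dual_norm_ge phi (u := 0) _); rewrite // is_norm0 ler01.
Qed.

Lemma dual_normD phi psi :
  dual_norm N (phi + psi) <= dual_norm N phi + dual_norm N psi.
Proof.
apply: dual_norm_le => u Nu; apply: le_trans (ler_normD (phi u) (psi u)) _.
by rewrite lerD ?dual_norm_ge.
Qed.

Lemma dual_normZ (a : R) phi : dual_norm N (a *: phi) = `|a| * dual_norm N phi.
Proof.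
have leZ b psi : dual_norm N (b *: psi) <= `|b| * dual_norm N psi.
  apply: dual_norm_le => u Nu.
  have -> : (b *: psi) u = b * psi u by [].
  by rewrite normrM ler_wpM2l ?dual_norm_ge.
apply/eqP; rewrite eq_le leZ /=.
have [->|a0] := eqVneq a 0; first by rewrite normr0 mul0r dual_norm_ge0.
rewrite -ler_pdivlMl ?normr_gt0// -normfV.
by rewrite (le_trans _ (leZ _ _))// scalerA mulVf// scale1r.
Qed.

Lemma dual_norm_eq0 phi : dual_norm N phi = 0 -> phi = 0.
Proof.
have [_ NZ _] := normN.
move=> phi0; apply: val_inj; apply/funext => u /=.
apply/eqP; rewrite -normr_le0; have [Nu|Nu] := leP (N u) 1.
  by rewrite -phi0 dual_norm_ge.
have Nu0 : 0 < N u by exact: lt_trans Nu.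
have := @dual_norm_ge phi ((N u)^-1 *: u).
rewrite NZ gtr0_norm ?invr_gt0// mulVf ?gt_eqF// => /(_ (lexx _)).
by rewrite phi0 dualZ normrM pmulr_rle0// normr_gt0 invr_eq0 gt_eqF.
Qed.

(** Strict convexity speaks of segments in the unit sphere only.  If the
    midpoint had norm at least [M], the larger of the two norms, then by
    convexity the norm would be [M] on the whole segment, since the points
    of parameters [t] and [1 - t] have the same midpoint; dividing by [M] gives
    a segment in the unit sphere. *)
Lemma dual_norm_midpoint phi psi : strictly_convex (dual_norm N) ->
  phi <> psi -> dual_norm N (2^-1 *: (phi + psi)) <
    Num.max (dual_norm N phi) (dual_norm N psi).
Proof.
move=> scN phipsi; set P := dual_norm N; set M := Num.max _ _.
rewrite ltNge; apply/negP => Mmid; apply: scN.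
have phiM : P phi <= M by rewrite le_max lexx.
have psiM : P psi <= M by rewrite le_max lexx orbT.
have M0 : 0 < M.
  rewrite lt_neqAle (le_trans (dual_norm_ge0 phi) phiM) andbT.
  apply/eqP => M0; apply: phipsi.
  have zero chi : P chi <= M -> chi = 0.
    move=> chiM; apply: dual_norm_eq0; apply/eqP.
    by rewrite eq_le dual_norm_ge0 andbT M0.
  by transitivity (0 : dual V); [|symmetry]; exact: zero.
pose g t := P ((1 - t) *: phi + t *: psi).
have gM t : 0 <= t <= 1 -> g t <= M.
  move=> /andP[t0 t1]; apply: le_trans (dual_normD _ _) _.
  rewrite !dual_normZ !ger0_norm ?subr_ge0//.
  have -> : M = (1 - t) * M + t * M by rewrite -mulrDl subrK mul1r.
  by rewrite lerD// ler_wpM2l// subr_ge0.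
have gE t : 0 <= t <= 1 -> g t = M.
  move=> t01; apply/eqP; rewrite eq_le gM//=.
  have t01' : 0 <= 1 - t <= 1.
    by move: t01 => /andP[? ?]; apply/andP; split; lra.
  have : 2 * M <= g t + g (1 - t).
    rewrite -ler_pdivlMl//; apply: le_trans Mmid _.
    rewrite /P dual_normZ ger0_norm ?invr_ge0// ler_wpM2l ?invr_ge0//.
    apply: le_trans (dual_normD _ _); rewrite le_eqVlt; apply/orP; left.
    apply/eqP; congr (dual_norm N _).
    by rewrite subKr addrACA -!scalerDl subrK (addrC t) subrK !scale1r.
  rewrite mulr_natl mulr2n => h; rewrite -(lerD2r (g (1 - t))).
  exact: le_trans (lerD (lexx M) (gM _ t01')) h.
exists (M^-1 *: phi), (M^-1 *: psi); split.
  by move/(scalerI (invr_neq0 (lt0r_neq0 M0))).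
move=> t t01; rewrite !scalerA !(mulrC _ M^-1) -!scalerA -scalerDr dual_normZ.
by rewrite -/P -/(g t) gE// gtr0_norm ?invr_gt0// mulVf// gt_eqF.
Qed.

(** The slice [{chi | q < chi u}] with [N u <= 1] does not meet the dual ball of
    radius [q].  For [q] between the norm of the midpoint and the larger norm,
    a slice containing both functionals would contain their midpoint. *)
Lemma strictly_convex_slices phi psi : strictly_convex (dual_norm N) ->
  phi <> psi -> exists q : rat,
    (exists2 u, N u <= 1 & ratr q < phi u \/ ratr q < psi u) /\
    (forall u, N u <= 1 -> ratr q < phi u -> ratr q < psi u -> False).
Proof.
move=> scN phipsi.
have [q] := rat_in_itvoo (dual_norm_midpoint scN phipsi).
rewrite in_itv /= => /andP[midq qmax]; exists q; split.
  have big chi : ratr q < dual_norm N chi ->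
      exists2 u, N u <= 1 & ratr q < chi u.
    move=> qchi; have [||_ [u Nu <-]] := @sup_gt R
      [set `|chi u| | u in [set u | N u <= 1]] (ratr q) => //.
      by exists `|chi 0|; exists 0 => //=; rewrite is_norm0 ler01.
    rewrite ltr_normr => /orP[qu|qu]; first by exists u.
    exists (- u).
      by have [_ NZ _] := normN; rewrite -scaleN1r NZ normrN1 mul1r.
    by rewrite -scaleN1r dualZ mulN1r.
  by move: qmax; rewrite lt_max => /orP[] /big[u Nu qu]; exists u => //;
    [left|right].
move=> u Nu qphi qpsi.
have := le_lt_trans (dual_norm_ge _ Nu) midq.
have -> : (2^-1 *: (phi + psi)) u = 2^-1 * (phi u + psi u) by [].
move=> /(le_lt_trans (ler_norm _)); lra.
Qed.

End dual_norm_theory.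

(** * Point masses and the slices they meet *)

Lemma contractive_dual (R : realType) (V : normedModType R) (phi : V -> R^o) :
  linear phi -> (forall u, `|phi u| <= `|u|) -> phi \in @dual_pred R V.
Proof.
move=> lphi phi1; apply/asboolP; split=> // u.
apply/cvgrPdist_lt => e e0; apply/nbhs_normP; exists e => // v uv.
apply: le_lt_trans uv; apply: le_trans (phi1 _).
have := lphi (-1) v u; rewrite !scaleN1r (addrC (- v)) => ->.
by rewrite addrC.
Qed.

Section evaluation.
Context {R : realType} {T : topologicalType} {cT : compact [set: T]}.
Local Notation CT := (C_space R cT).

Definition eval_at (x : T) : CT -> R^o := fun f => C_fun f x.

Lemma eval_at_dual x : eval_at x \in @dual_pred R CT.
Proof.
apply: contractive_dual => // f; exact: sup_norm_ge.
Qed.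

Definition delta x : dual CT := Dual (eval_at_dual x).

Lemma delta_inj : hausdorff_space T -> injective delta.
Proof.
move=> hT x y dxy; apply: contrapT => xy.
have cl (z : T) : closed [set z].
  exact/accessible_closed_set1/hausdorff_accessible.
have [|f [cf _ fx fy]] :=
    @compact_urysohn R T [set x] [set y] hT cT (cl x) (cl y).
  by rewrite -subset0 => z [/= -> /xy].
have : delta x (C_mk cf) = delta y (C_mk cf) by rewrite dxy.
rewrite /= /eval_at /= [LHS]fx// [RHS]fy// => /eqP.
by rewrite eq_sym oner_eq0.
Qed.

(** The slices of [strictly_convex_slices], restricted to the point masses, are
    the open sets [{x | q < u x}] of [T]. *)
Lemma strictly_convex_dual_families (N : CT -> R) :
  hausdorff_space T -> equivalent_norm N -> strictly_convex (dual_norm N) ->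
  exists U : rat -> set (set T), (forall q V, U q V -> open V) /\
    forall x y, x <> y -> exists q,
      (covered U q x \/ covered U q y) /\ ~ linked U q x y.
Proof.
move=> hT eqN scN.
pose slice (q : rat) (u : CT) := [set x | ratr q < C_fun u x].
exists (fun q => [set slice q u | u in [set u | N u <= 1]]); split.
  move=> q _ [u _ <-].
  have -> : slice q u = C_fun u @^-1` `]ratr q, +oo[.
    by apply/seteqP; split=> x /=; rewrite in_itv /= andbT.
  apply: open_comp; last exact: interval_open.
  by move=> x _; exact: C_fun_continuous.
move=> x y xy.
have [|q [[u Nu qu] qn]] :=
    strictly_convex_slices eqN scN (phi := delta x) (psi := delta y).
  by move/(delta_inj hT).
exists q; split.
  by case: qu => qu; [left|right]; exists (slice q u) => //; exists u.
by move=> [_ [[v Nv <-] vx vy]]; exact: qn Nv vx vy.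
Qed.

End evaluation.

(** * Metrisability *)

Theorem corollary1p6 (R : realType) (d : Order.disp_t)
    (K : orderTopologicalType d) (cK : compact [set: K])
    (hN : exists N : C_space R cK -> R,
        equivalent_norm N /\ strictly_convex (dual_norm N)) :
  metrizable R K.
Proof.
have [N [eqN scN]] := hN.
have [K0|K0] := pselect ([set: K] !=set0); last first.
  have noK (x : K) : False by apply: K0; exists x.
  by exists (fun _ _ => 0); split=> x; case: (noK x).
have [U [Uo Usep]] := strictly_convex_dual_families order_hausdorff eqN scN.
have [n V UV|n V UV|x y xy|D cD Dsep] :=
    @order_separable d K rat U (compact_order_lub cK K0).
- exact/open_left_open/(Uo n).
- exact/open_right_open/(Uo n).
- by apply: Usep => xE; rewrite xE ltxx in xy.
exact: order_separable_metrizable cK cD Dsep.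
Qed.
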